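(* Let $k \geq 1$ and $n \geq 2k$ be integers. For $1 < h < n$ let $d_h = \gcd(n,h)$, and when $\frac{n}{d_h}$ divides $k$ let $l_k = \frac{k\, d_h}{n}$. Then $$\langle \phi, \chi^{(2n-k,k)} \rangle_{S_{2n}} = \frac{1}{n}\Bigg[\binom{n}{k} + \sum_{\substack{1<h<n \\ d_h \neq 1 \\ \frac{n}{d_h} \mid k}} \binom{d_h}{l_k}\Bigg].$$
   Context: Let $\sigma = (1\ 2\ \cdots\ n) \in S_n$, regarded as an element of $S_{2n}$ via the natural inclusion $S_n \subseteq S_{2n}$ (permutations fixing $n+1,\dots,2n$). Let $C = C_{S_{2n}}(\sigma)$ be the centralizer of $\sigma$ in $S_{2n}$, $1_C$ its trivial character, and $\phi = \operatorname{Ind}_C^{S_{2n}} 1_C$. For a partition $\lambda \vdash m$, $\chi^\lambda$ denotes the irreducible complex character of $S_m$ indexed by $\lambda$ in the standard way. $\langle\cdot,\cdot\rangle_{G}$ is the usual inner product of class functions on $G$. *)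

(* Defs.v *)
From HB Require Import structures.
From mathcomp Require Import all_boot all_order all_algebra all_fingroup all_solvable all_field all_character.
Set Implicit Arguments.
Unset Strict Implicit.
Unset Printing Implicit Defensive.
Import Order.TTheory GRing.Theory Num.Theory.

(* S_m is realised as the group [set: {perm 'I_m}] of all permutations of
   {0,...,m-1}; the points 1..m of the paper are 0..m-1 here. *)

Definition ncycle_fun (n : nat) (i : 'I_(n.*2)) : 'I_(n.*2) :=
  if i < n then insubd i (i.+1 %% n) else i.

Lemma ncycle_val n (i : 'I_(n.*2)) :
  val (ncycle_fun i) = if i < n then i.+1 %% n else i.
Proof.
rewrite /ncycle_fun; case: ifP => // lt_in.
rewrite val_insubd; case: ifP => // /negP[].
have n0 : 0 < n by apply: leq_ltn_trans lt_in.
by apply: leq_trans (ltn_pmod i.+1 n0) _; rewrite -addnn leq_addr.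
Qed.

Lemma ncycle_inj n : injective (@ncycle_fun n).
Proof.
move=> i j /(congr1 val); rewrite !ncycle_val => E; apply/val_inj => /=.
have mod_eq (a : nat) : a < n -> a.+1 %% n = if a.+1 == n then 0 else a.+1.
  move=> lt_an; case: eqP => [-> | /eqP ne]; first by rewrite modnn.
  by rewrite modn_small // ltn_neqAle ne lt_an.
case: ifP E => ilt; case: ifP => jlt E.
- move: E; rewrite !mod_eq //.
  case: eqP => [Ei | _]; case: eqP => [Ej | _] //.
    by move=> _; apply/eqP; rewrite -eqSS Ei Ej.
  by move=> -[].
- have n0 : 0 < n by apply: leq_ltn_trans ilt.
  by move: (ltn_pmod i.+1 n0); rewrite E jlt.
- have n0 : 0 < n by apply: leq_ltn_trans jlt.
  by move: (ltn_pmod j.+1 n0); rewrite -E ilt.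
- by [].
Qed.

Definition sigma_cycle (n : nat) : {perm 'I_(n.*2)} := perm (@ncycle_inj n).

Local Open Scope ring_scope.

Definition phi_ind (n : nat) : 'CF([set: {perm 'I_(n.*2)}]) :=
  'Ind[[set: {perm 'I_(n.*2)}]] (1 : 'CF('C[sigma_cycle n])).

(* Young subgroup S_(m-j) x S_j, realised as the setwise stabiliser of the
   j-subset {0,...,j-1} of 'I_m. *)
Definition young2 (m j : nat) : {group {perm 'I_m}} :=
  'C[[set i : 'I_m | (i < j)%N] | ('P)^*]%G.

Definition young_perm_char (m j : nat) : 'CF([set: {perm 'I_m}]) :=
  'Ind[[set: {perm 'I_m}]] (1 : 'CF(young2 m j)).

(* The irreducible character chi^(m-k,k) of S_m (for 2k <= m), defined in
   the standard way (James): the unique irreducible constituent of the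
   permutation module M^(m-k,k) that is not a constituent of any M^mu with
   mu strictly dominating (m-k,k), i.e. mu = (m-j,j) with j < k. *)
Definition chi2 (m k : nat) : 'CF([set: {perm 'I_m}]) :=
  match [pick i : Iirr [set: {perm 'I_m}] |
          (i \in irr_constt (young_perm_char m k)) &&
          [forall j : 'I_k, i \notin irr_constt (young_perm_char m j)]] with
  | Some i => 'chi_i
  | None => 0
  end.

(* Main.v *)
(* Write pi_k for the permutation character of S_m on k-subsets.  For any
   subgroup H, <Ind 1_H, pi_k> is the number of H-orbits on k-subsets.  Taking H
   to be the stabiliser of a j-subset with j <= k, the orbits are told apart by
   the size of the intersection with that subset, so <pi_j, pi_k> = j + 1; hence
   pi_k - pi_(k-1) is a virtual character of norm 1 pairing to 1 with pi_k, and
   it must be chi^(m-k,k).  Thus <phi, chi^(2n-k,k)> is the number of C-orbits on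
   k-subsets minus the number on (k-1)-subsets.  A C-orbit of k-subsets A is
   determined by the <sigma>-orbit of the trace of A on the support of sigma, a
   set of size at most k, so the difference is the number of <sigma>-orbits on
   k-subsets of the support.  Burnside's lemma counts these: the sets fixed by
   sigma^h are the unions of residue classes modulo d = gcd(n, h).  The term
   h = 0 gives C(n, k), and d = 1 contributes nothing since n does not divide k. *)
Require Import Defs.
From HB Require Import structures.
From mathcomp Require Import all_boot all_order all_algebra all_fingroup all_solvable all_field all_character.
Import Order.TTheory GRing.Theory Num.Theory.
Set Implicit Arguments.
Unset Strict Implicit.
Unset Printing Implicit Defensive.
Local Open Scope ring_scope.

(** * Induced trivial characters and orbit counts *)

Lemma cfInd1_stabE (aT : finGroupType) (rT : finType) (to : {action aT &-> rT})
    (G K : {group aT}) (x : rT) (g : aT) :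
  K = 'C_G[x | to]%g :> {set aT} -> g \in G ->
  'Ind[G] (1 : 'CF(K)) g = #|'Fix_(orbit to G x | to)[g]%g|%:R.
Proof.
move=> defK Gg; have sKG : K \subset G by rewrite defK subsetIl.
rewrite cfIndE //; under eq_bigr do rewrite cfun1E.
(* After inverting [y], the summand tests whether [y g y^-1] stabilises [x], that is, whether [g]
   fixes [to x y]. *)
rewrite -natr_sum (reindex_inj invg_inj) /=.
apply: (mulfI (neq0CG K)); rewrite mulVKf ?neq0CG // -natrM; congr (_%:R).
under eq_bigl do rewrite groupV.
rewrite (partition_big (to x) (mem (orbit to G x))) /=; last first.
  by move=> y Gy; exact: mem_orbit.
rewrite -sum1_card big_distrr /= muln1.
rewrite [RHS](eq_bigl (fun z => (z \in orbit to G x) && (z \in 'Fix_to[g]%g))); last first.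
  by move=> z; rewrite in_setI.
rewrite [RHS]big_mkcondr /=.
apply: eq_bigr => _ /orbitP[a Ga <-].
transitivity (\sum_(y in amove to G x (to x a)) (to x a \in 'Fix_to[g]%g : nat))%N.
  apply: eq_big => [y | y /andP[Gy /eqP <-]]; first by rewrite inE.
  congr nat_of_bool; rewrite defK inE groupJ ?groupV //=.
  rewrite conjgE invgK mulgA; apply/astab1P/afix1P; rewrite !actM.
    by move=> E; rewrite -{2}E actKV.
  by move=> ->; rewrite actK.
(* The elements of [G] taking [x] to a given point of its orbit form a right coset of [K], whence
   the factor [#|K|]. *)
rewrite sum_nat_const amove_act ?subsetT // card_rcoset -defK.
by case: ifP; rewrite ?muln1 ?muln0.
Qed.

(** Frobenius reciprocity turns the product into an average over [H] of numbers of fixed points,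
    which the Cauchy-Frobenius lemma evaluates. *)
Lemma cfdot_Ind1_stab (aT : finGroupType) (rT : finType)
    (to : {action aT &-> rT}) (G H K : {group aT}) (x : rT) :
  H \subset G -> K = 'C_G[x | to]%g :> {set aT} ->
  '['Ind[G] (1 : 'CF(H)), 'Ind[G] (1 : 'CF(K))]
    = #|[set orbit to H y | y in orbit to G x]|%:R.
Proof.
move=> sHG defK; rewrite -cfdot_Res_r cfdotE.
have actsH : [acts H, on orbit to G x | to].
  by apply: subset_trans sHG _; apply: acts_orbit; apply: subsetT.
apply: (mulfI (neq0CG H)); rewrite mulVKf ?neq0CG // -natrM mulnC.
rewrite -(Frobenius_Cauchy actsH) natr_sum; apply: eq_bigr => h Hh.
rewrite cfun1E Hh mul1r cfResE // (cfInd1_stabE defK) ?conjC_nat //.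
exact: (subsetP sHG).
Qed.

Lemma leq_card_imset_ker (T D1 D2 : finType) (f : T -> D1) (g : T -> D2)
    (S : {set T}) :
  {in S &, forall x y, g x = g y -> f x = f y} -> (#|f @: S| <= #|g @: S|)%N.
Proof.
move=> fg; have [-> | [x0 Sx0]] := set_0Vmem S; first by rewrite !imset0 !cards0.
(* On [S], [f] factors through [g] by way of the chosen preimage [r y]; the default [x0] is taken
   only off [g @: S]. *)
pose r y := odflt x0 [pick x in S | g x == y].
apply: leq_trans (leq_imset_card (f \o r) (g @: S)); apply: subset_leq_card.
apply/subsetP=> _ /imsetP[x Sx ->]; apply/imsetP; exists (g x) => /=.
  exact: imset_f.
rewrite /r; case: pickP => [y /andP[Sy /eqP gy] | /(_ x)]; first exact: fg.
by rewrite Sx eqxx.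
Qed.

Lemma card_orbits_invariant (aT : finGroupType) (rT D : finType)
    (to : {action aT &-> rT}) (G : {group aT}) (S : {set rT}) (f : rT -> D) :
  {in S &, forall x y, f x = f y <-> x \in orbit to G y} ->
  #|[set orbit to G x | x in S]| = #|f @: S|.
Proof.
move=> fP; apply/eqP; rewrite eqn_leq; apply/andP.
by split; apply: leq_card_imset_ker => x y Sx Sy;
  [move=> /(fP x y Sx Sy)/orbit_eqP | move=> /orbit_eqP/(fP x y Sx Sy)].
Qed.

(** * Permutations carrying one subset to another *)

Lemma perm_of_card_fibres (m : nat) (D : eqType) (f g : 'I_m -> D) :
  (forall d, #|[set x | f x == d]| = #|[set x | g x == d]|) ->
  exists s : {perm 'I_m}, forall x, g (s x) = f x.
Proof.
move=> fg.
have countE (h : 'I_m -> D) d :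
    count_mem d [tuple h x | x < m] = #|[set x | h x == d]|.
  by rewrite count_map -sum1_count -sum1dep_card big_enum_cond.
(* Equal multiplicities make one value tuple a rearrangement of the other; the rearranging
   permutation is [s]. *)
have : perm_eq [tuple f x | x < m] [tuple g x | x < m].
  by apply/allP => d _; rewrite /= !countE fg.
case/tuple_permP=> s /val_inj E; exists s => x.
by have := congr1 (fun t => tnth t x) E; rewrite !tnth_mktuple.
Qed.

Lemma setact_permP (T : finType) (s : {perm T}) (A B : {set T}) :
  (forall x, (s x \in B) = (x \in A)) <-> ('P^*)%act A s = B.
Proof.
split=> [sAB | <- x]; last by rewrite mem_imset //; exact: perm_inj.
apply/setP=> y; apply/imsetP/idP => [[x Ax ->] | By]; first by rewrite sAB.
by exists (s^-1 y)%g; rewrite -?sAB ?permKV //= apermE permKV.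
Qed.

Lemma card_ord_lt (m j : nat) : (j <= m)%N -> #|[set i : 'I_m | (i < j)%N]| = j.
Proof.
move=> le_jm; rewrite -sum1_card.
rewrite (eq_bigl (fun i : 'I_m => i < j)%N) => [|i]; last by rewrite inE.
by rewrite -(big_ord_widen m (fun=> 1%N) le_jm) sum1_card card_ord.
Qed.

Lemma exists_set_inter (T : finType) (J X : {set T}) (k : nat) :
  X \subset J -> (#|X| <= k)%N -> (k - #|X| <= #|~: J|)%N ->
  exists2 A : {set T}, #|A| = k & A :&: J = X.
Proof.
move=> sXJ leXk; rewrite -bin_gt0 -cards_draws => /card_gt0P[Y].
rewrite inE => /andP[sYJ /eqP cardY]; exists (X :|: Y).
  rewrite cardsU cardY (disjoint_setI0 (disjointWl sXJ _)) ?cards0 ?subn0 ?subnKC //.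
  by rewrite disjoint_sym disjoints_subset.
rewrite setIUl (setIidPl sXJ) [Y :&: J]disjoint_setI0 ?setU0 //.
by rewrite disjoints_subset.
Qed.

(** Membership is added to the label: matching [(c x, x \in A)] with [(c x, x \in B)] preserves [c]
    and carries [A] to [B]. Outside the two sets the fibre sizes agree by subtraction within each
    label class. *)
Lemma perm_of_labelled_sets (m : nat) (D : eqType) (c : 'I_m -> D)
    (A B : {set 'I_m}) :
  (forall d, #|A :&: [set x | c x == d]| = #|B :&: [set x | c x == d]|) ->
  exists2 s : {perm 'I_m}, forall x, c (s x) = c x & ('P^*)%act A s = B.
Proof.
move=> cAB.
have [|s sE] := @perm_of_card_fibres m _ (fun x => (c x, x \in A)) (fun x => (c x, x \in B)).
  case=> d b; pose Cd := [set x | c x == d].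
  have fibE (X : {set 'I_m}) : [set x | (c x, x \in X) == (d, b)]
      = if b then X :&: Cd else Cd :\: X.
    by apply/setP=> x; rewrite !inE xpair_eqE; case: b; rewrite !inE;
      case: (x \in X); rewrite ?andbT ?andbF.
  rewrite !fibE; case: b {fibE}; first exact: cAB.
  apply/eqP; rewrite -(eqn_add2l #|Cd :&: A|) cardsID setIC (cAB d).
  by rewrite -/Cd setIC cardsID.
exists s => [x|]; first by case: (sE x).
by apply/setact_permP => x; case: (sE x).
Qed.

(** * Young permutation characters and [chi2] *)

Lemma orbit_initial_segment (m k : nat) : (k <= m)%N ->
  orbit 'P^* [set: {perm 'I_m}] [set i : 'I_m | (i < k)%N]
    = [set A : {set 'I_m} | #|A| == k].
Proof.
move=> le_km; apply/setP=> A; rewrite inE; apply/imsetP/eqP => [[s _ ->] | cardA].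
  by rewrite card_setact card_ord_lt.
have [|s _ sA] := @perm_of_labelled_sets m _ (fun=> tt) [set i : 'I_m | (i < k)%N] A.
  by case; rewrite !(setIidPl _) ?card_ord_lt //; apply/subsetP=> x; rewrite inE.
by exists s; rewrite ?inE.
Qed.

Lemma cfdot_Ind1_young (m k : nat) (H : {group {perm 'I_m}}) : (k <= m)%N ->
  '['Ind[[set: {perm 'I_m}]] (1 : 'CF(H)), young_perm_char m k]
    = #|[set orbit 'P^* H A | A in [set A : {set 'I_m} | #|A| == k]]|%:R.
Proof.
move=> le_km; rewrite -(orbit_initial_segment le_km).
by apply: cfdot_Ind1_stab; rewrite ?subsetT ?setTI.
Qed.

Lemma cfdot_young (m j k : nat) : (j <= k)%N -> (j + k <= m)%N ->
  '[young_perm_char m j, young_perm_char m k] = j.+1%:R.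
Proof.
move=> le_jk le_jkm; have le_km := leq_trans (leq_addl j k) le_jkm.
have le_jm := leq_trans le_jk le_km.
rewrite cfdot_Ind1_young //; congr (_%:R).
pose J := [set i : 'I_m | (i < j)%N]; have cardJ : #|J| = j := card_ord_lt le_jm.
have cardCJ : #|~: J| = (m - j)%N.
  by rewrite -[in RHS](card_ord m) -(cardsC J) cardJ addKn.
have ltJ (A : {set 'I_m}) : (#|A :&: J| < j.+1)%N.
  by rewrite ltnS -cardJ subset_leq_card ?subsetIr.
rewrite (card_orbits_invariant (f := fun A => inord #|A :&: J| : 'I_j.+1)).
  rewrite -[RHS]card_ord -cardsT; congr #|pred_of_set _|; apply/setP=> i.
  rewrite inE; apply/imsetP.
  have: (0 < #|[set X : {set 'I_m} | X \subset J & #|X| == i]|)%N.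
    by rewrite cards_draws bin_gt0 cardJ -ltnS.
  case/card_gt0P=> X; rewrite inE => /andP[sXJ /eqP cardX].
  have le_ij : (i <= j)%N by rewrite -ltnS.
  have [|| A cardA AJ] := @exists_set_inter _ J X k sXJ.
  - by rewrite cardX (leq_trans le_ij).
  (* The bound [j + k <= m] leaves enough room outside [J] even when [X] is empty. *)
  - rewrite cardCJ cardX.
    by rewrite (leq_trans (leq_subr _ _)) // leq_subRL.
  exists A; first by rewrite inE cardA.
  by apply/val_inj; rewrite /= AJ cardX inordK.
move=> A B; rewrite !inE => /eqP cardA /eqP cardB; split=> [/(congr1 val) | ].
  rewrite /= !inordK // => ABJ; rewrite orbit_sym.
  (* Labelling by membership in [J] forces [s] to stabilise [J]. *)
  have [|s sJ sA] := @perm_of_labelled_sets m _ (mem J) A B; last first.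
    apply/orbitP; exists s => //; apply/astab1P/setact_permP => x; exact: sJ.
  move=> d; rewrite (_ : [set x | _] = if d then J else ~: J); last first.
    by apply/setP=> x; rewrite !inE /=; case: d; rewrite !inE ?eqb_id ?eqbF_neg.
  case: d => //; apply/eqP.
  by rewrite -(eqn_add2l #|A :&: J|) -!setDE cardsID ABJ cardsID cardA cardB.
move=> /orbitP[s /astab1P sJ <-]; rewrite -/J in sJ; congr inord.
have sE X : ('P^*)%act X s = s @: X by [].
rewrite -[in LHS]sJ !sE -imsetI ?card_imset //; first exact: perm_inj.
by move=> x y _ _; apply: perm_inj.
Qed.

Lemma chi2E (m k : nat) : (0 < k)%N -> (k.*2 <= m)%N ->
  chi2 m k = young_perm_char m k - young_perm_char m k.-1.
Proof.
case: k => // k _ le_km /=; set pk := young_perm_char m k.+1.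
set pk1 := young_perm_char m k.
have char_y j : young_perm_char m j \is a character by rewrite cfInd_char ?cfun1_char.
have lkm i j : (i <= k.+1 -> j <= k.+1 -> i + j <= m)%N.
  move=> le_i le_j; apply: leq_trans le_km.
  by rewrite -addnn leq_add.
have dot_sym i : '[pk, young_perm_char m i] = '[young_perm_char m i, pk].
  by rewrite [LHS]cfdotC conj_natr ?Cnat_cfdot_char ?char_y.
have dot_k j : (j <= k)%N -> '[young_perm_char m j, pk - pk1] = 
   (j.+1%:R - j.+1%:R : algC).
  move=> le_jk; have le_jk1 := leqW le_jk; rewrite cfdotBr !cfdot_young ?lkm //.
have dot_pk : '[pk, pk - pk1] = 1.
  rewrite cfdotBr (dot_sym k) !cfdot_young // ?lkm //.
  by rewrite -natrB // subSnn.
have norm1 : '[pk - pk1] = 1.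
  by rewrite [LHS]cfdotBl dot_pk dot_k // subrr subr0.
have [|b [i def_i]] := vchar_norm1P _ norm1.
  by apply: rpredB; apply: char_vchar; apply: char_y.
have Eb : pk - pk1 = 'chi_i.
  (* A minus sign would make the multiplicity of ['chi_i] in the character [pk] equal to [-1]. *)
  case: b def_i => [def_i | ->]; last by rewrite scale1r.
  have := Cnat_cfdot_char_irr i (char_y k.+1); rewrite -/pk.
  move/natr_ge0; rewrite -oppr_le0 -cfdotNr -scaleN1r -[-1]expr1 -def_i dot_pk.
  by rewrite ler10.
rewrite Eb /chi2; case: pickP => [l /andP[] | /(_ i)/negP[]].
  (* An index [l] passing the test is no constituent of [pk1] ([ord_max] is [k]), so it occurs in
     [pk - pk1] and equals [i]. *)
  move=> l_pk /forallP/(_ ord_max); rewrite !irr_consttE in l_pk *.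
  rewrite -/pk in l_pk *; move: l_pk.
  rewrite -[pk](subrK pk1) Eb cfdotDl negbK => + /eqP E.
  rewrite E addr0 cfdot_irr. by case: (i =P l) => [-> | _]; rewrite ?eqxx.
(* The index [i] itself passes the test, so the default [0] of [chi2] is never returned. *)
apply/andP; split; first by rewrite irr_consttE -Eb -/pk dot_pk oner_eq0.
by apply/forallP=> j; rewrite irr_consttE -Eb dot_k ?subrr ?eqxx // -ltnS.
Qed.

(** * The cycle, its centralizer and their orbits on subsets *)

Lemma val_sigma_cycleX (n h : nat) (i : 'I_(n.*2)) :
  (sigma_cycle n ^+ h)%g i = (if i < n then (i + h) %% n else i)%N :> nat.
Proof.
elim: h => [|h IH]; first by rewrite perm1 addn0; case: ifP => // /modn_small.
rewrite expgSr permM permE ncycle_val IH; case lt_in: (i < n)%N; last by rewrite lt_in.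
by rewrite ltn_pmod ?(leq_ltn_trans _ lt_in) // addnS -addn1 modnDml addn1.
Qed.

Lemma order_sigma_cycle (n : nat) : (0 < n)%N -> #[sigma_cycle n]%g = n.
Proof.
move=> n_gt0; apply/eqP; rewrite eqn_dvd order_dvdn; apply/andP; split.
  apply/eqP/permP=> i; apply/val_inj; rewrite /= val_sigma_cycleX perm1.
  by case: ifP => // /modn_small E; rewrite modnDr.
have lt_n : (0 < n.*2)%N by rewrite double_gt0.
have := val_sigma_cycleX #[sigma_cycle n]%g (Ordinal lt_n).
by rewrite expg_order perm1 /= n_gt0 /dvdn add0n => <-.
Qed.

Definition cycle_support (n : nat) := [set i : 'I_(n.*2) | (i < n)%N].

(** A commuting permutation preserves the set of moved points. There it is determined by the image
    of [0], because the powers of the cycle are transitive on the support; that image is the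
    exponent [p]. *)
Lemma cent_sigma_cycle (n : nat) (c : {perm 'I_(n.*2)}) : (1 < n)%N ->
  c \in 'C[sigma_cycle n]%g ->
  (forall i, (c i \in cycle_support n) = (i \in cycle_support n)) /\
  exists p, {in cycle_support n, forall i, c i = (sigma_cycle n ^+ p)%g i}.
Proof.
move=> n_gt1 /cent1P cs; have n_gt0 := ltnW n_gt1.
(* For [n = 1] this would fail: [0] would lie in the support without being moved. *)
have suppE i : (i \in cycle_support n) = (sigma_cycle n i != i).
  rewrite inE -val_eqE /= -[sigma_cycle n]expg1 val_sigma_cycleX.
  case: ifP => [lt_in | _]; last by rewrite eqxx.
  rewrite addn1; case: (ltngtP i.+1 n) lt_in => // [lt_i1n _ | eq_n _].
    by rewrite modn_small // eqn_leq ltnn.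
  by rewrite eq_n modnn; case: i eq_n n_gt1 => [[|i] //= _] <-.
have csE h i : c ((sigma_cycle n ^+ h)%g i) = (sigma_cycle n ^+ h)%g (c i).
  have cX : commute c (sigma_cycle n ^+ h)%g by apply/commuteX/commute_sym.
  by rewrite -!permM cX.
have supp i : (c i \in cycle_support n) = (i \in cycle_support n).
  by rewrite !suppE -{1}[sigma_cycle n]expg1 -csE expg1 (inj_eq perm_inj).
split=> //; have lt_n : (0 < n.*2)%N by rewrite double_gt0.
pose i0 := Ordinal lt_n.
have sE i : i \in cycle_support n -> i = (sigma_cycle n ^+ i)%g i0.
  by rewrite inE => lt_in; apply/val_inj; rewrite /= val_sigma_cycleX /= n_gt0 modn_small.
have := sE (c i0); rewrite supp inE n_gt0 => /(_ isT).
move: (c i0 : nat) => p c0E; exists p => i Li.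
by rewrite {1}(sE i Li) csE c0E -permM -expgD addnC expgD permM -sE.
Qed.

Lemma setact_permI (T : finType) (s : {perm T}) (A B : {set T}) :
  ('P^*)%act (A :&: B) s = ('P^*)%act A s :&: ('P^*)%act B s.
Proof. by apply: imsetI => x y _ _; apply: perm_inj. Qed.

Lemma cycle_support_act (n : nat) (s : {perm 'I_(n.*2)}) :
  s \in <[sigma_cycle n]>%g ->
  ('P^*)%act (cycle_support n) s = cycle_support n.
Proof.
case/cycleP=> h ->; apply/setact_permP => i; rewrite !inE val_sigma_cycleX.
by case: ifP => // lt_in; rewrite ltn_pmod ?(leq_ltn_trans _ lt_in).
Qed.

Lemma card_cycle_support (n : nat) : #|cycle_support n| = n.
Proof. by apply: card_ord_lt; rewrite -addnn leq_addr. Qed.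

Lemma card_cycle_supportC (n : nat) : #|~: cycle_support n| = n.
Proof.
by apply/eqP; rewrite -(eqn_add2l n) -{1}(card_cycle_support n) cardsC card_ord addnn.
Qed.

(** A power of the cycle aligns the traces, and a permutation fixing the support pointwise then
    matches the rest. Conversely, a centralizing element acts on the support as a power of the
    cycle. *)
Lemma cent_sigma_orbitP (n : nat) (A B : {set 'I_(n.*2)}) :
  (1 < n)%N -> #|A| = #|B| ->
  orbit 'P^* <[sigma_cycle n]> (A :&: cycle_support n)
    = orbit 'P^* <[sigma_cycle n]> (B :&: cycle_support n)
  <-> A \in orbit 'P^* 'C[sigma_cycle n] B.
Proof.
set L := cycle_support n => n_gt1 cardAB; split.
  move/orbit_eqP/orbitP => [s Cs]; rewrite setact_permI (cycle_support_act Cs) -/L => sB.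
  set B' := ('P^*)%act B s in sB.
  have cardB' : #|B'| = #|A| by rewrite cardAB card_setact.
  (* Labels separate the points of the support and merge all others, so a label-preserving [t] fixes
     the support pointwise. *)
  pose lab i := if i \in L then Some i else None.
  have [|t tL tB'] := @perm_of_labelled_sets _ _ lab B' A.
    move=> d; case: (d : option _) => [j|]; last first.
      rewrite (_ : [set x | _] = ~: L); last first.
        by apply/setP=> x; rewrite !inE /lab inE; case: ifP.
      apply/eqP; rewrite -!setDE -(eqn_add2l #|B' :&: L|) cardsID sB cardsID.
      exact/eqP.
    rewrite (_ : [set x | _] = L :&: [set j]) ?setIA ?sB //.
    by apply/setP=> x; rewrite !inE /lab inE; case: ifP.
  apply/orbitP; exists (s * t)%g; last by rewrite actM.
  have tfix i : i \in L -> t i = i.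
    by move=> Li; have := tL i; rewrite /lab Li; case: ifP => // _ [].
  have tout i : i \notin L -> t i \notin L.
    by move=> /negPf Li; have := tL i; rewrite /lab Li; case: ifP.
  rewrite groupM //.
    by apply: (subsetP _ _ Cs); rewrite cycle_subG cent1id.
  have sigma_out i : i \notin L -> sigma_cycle n i = i.
    rewrite inE => /negPf lt_in; apply/val_inj.
    by rewrite /= -[sigma_cycle n]expg1 val_sigma_cycleX lt_in.
  have /setact_permP sigmaL := cycle_support_act (cycle_id (sigma_cycle n)).
  apply/cent1P/permP=> i; rewrite !permM; case: (boolP (i \in L)) => Li.
    by rewrite (tfix i Li) tfix // sigmaL.
  by rewrite !sigma_out ?tout.
case/orbitP=> c Cc <-.
have [cL [p cp]] := cent_sigma_cycle n_gt1 Cc.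
rewrite -{1}(_ : ('P^*)%act L c = L); last by apply/setact_permP.
rewrite -setact_permI; apply/orbit_eqP/orbitP.
exists (sigma_cycle n ^+ p)%g; first exact: mem_cycle.
by apply: eq_in_imset => i; rewrite inE => /andP[_ Li]; rewrite /= /aperm cp.
Qed.

(** The predicate covers both sizes at most [k], as [geq k], and size exactly [k], as [pred1 k]. *)
Definition sigma_orbits (n : nat) (P : pred nat) :=
  [set orbit 'P^* <[sigma_cycle n]> X
  | X in [set X : {set 'I_(n.*2)} | (X \subset cycle_support n) && P #|X|]].

(** Every subset of the support of size at most [k] is the trace of some [k]-subset, since the
    [n >= k] points outside can complete it. *)
Lemma card_cent_sigma_orbits (n k : nat) : (1 < n)%N -> (k <= n)%N ->
  #|[set orbit 'P^* 'C[sigma_cycle n] A | A in [set A : {set 'I_(n.*2)} | #|A| == k]]|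
  = #|sigma_orbits n (geq k)|.
Proof.
move=> n_gt1 le_kn; set L := cycle_support n.
rewrite (card_orbits_invariant (f := fun A => orbit 'P^* <[sigma_cycle n]> (A :&: L))).
  rewrite /sigma_orbits [in RHS](_ : [set X | _] = (fun A => A :&: L) @: [set A : {set 'I_(n.*2)} | #|A| == k]).
    by rewrite -imset_comp.
  apply/setP=> X; rewrite inE; apply/andP/imsetP=> [[sXL leXk]|[A]]; last first.
    by rewrite inE => /eqP <- ->; rewrite subsetIr /= subset_leq_card ?subsetIl.
  have [|A cardA AL] := @exists_set_inter _ L X k sXL leXk.
    by rewrite card_cycle_supportC (leq_trans (leq_subr _ _)).
  by exists A; rewrite ?inE ?cardA ?AL.
move=> A B; rewrite !inE => /eqP cardA /eqP cardB.
by apply: cent_sigma_orbitP; rewrite ?cardA ?cardB.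
Qed.

(** The action preserves cardinality, so orbits of sets of different sizes are distinct. *)
Lemma card_sigma_orbits_leq (n k : nat) :
  #|sigma_orbits n (geq k.+1)|
    = (#|sigma_orbits n (geq k)| + #|sigma_orbits n (pred1 k.+1)|)%N.
Proof.
have <- : sigma_orbits n (geq k) :|: sigma_orbits n (pred1 k.+1)
    = sigma_orbits n (geq k.+1).
  rewrite -imsetU; congr (imset _ (mem (pred_of_set _))); apply/setP=> X; rewrite !inE -andb_orr.
  by rewrite orbC -leq_eqVlt.
rewrite cardsU disjoint_setI0 ?cards0 ?subn0 // -setI_eq0.
apply/set0Pn=> -[_ /setIP[/imsetP[X + ->] /imsetP[Y + /orbit_eqP/orbitP[s _ sY]]]].
by rewrite !inE -sY card_setact => /andP[_ /= leYk] /andP[_ /= /eqP eqYk]; rewrite eqYk ltnn in leYk.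
Qed.

(** * Subsets fixed by a power of the cycle, and the Burnside count *)

Lemma card_residue_preim (d q : nat) (b : pred nat) :
  (\sum_(0 <= i < q * d) b (i %% d) = q * \sum_(0 <= i < d) b i)%N.
Proof.
elim: q => [|q IH]; first by rewrite !mul0n big_geq.
rewrite mulSnr (@big_cat_nat _ _ _ (q * d)) ?leq_addr //= IH mulSnr; congr (_ + _)%N.
rewrite -{1}[(q * d)%N]add0n big_addn addKn !big_mkord.
by apply: eq_bigr => i _; rewrite addnC modnMDl modn_small.
Qed.

(** Going through [image val B] tests the number [i %% d] without a proof that it is below [d]. *)
Definition periodic_set (n d : nat) (B : {set 'I_d}) : {set 'I_(n.*2)} :=
  [set i : 'I_(n.*2) | (i < n)%N && (i %% d \in image val B)%N].

Lemma mem_image_val (d : nat) (B : {set 'I_d}) (r : 'I_d) :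
  (val r \in image val B) = (r \in B).
Proof. exact: (mem_image val_inj). Qed.

Lemma card_periodic_set (n d : nat) (B : {set 'I_d}) : (d %| n)%N ->
  #|periodic_set n B| = (n %/ d * #|B|)%N.
Proof.
move=> d_n; rewrite -sum1dep_card; under eq_bigl do rewrite andbC.
rewrite -(big_ord_widen_cond _ (fun i => i %% d \in image val B)%N (fun=> 1%N)); last first.
  by rewrite -addnn leq_addr.
rewrite big_mkcond -(big_mkord xpredT (fun i => (i %% d \in image val B : nat)))%N.
rewrite -{1}(divnK d_n) (card_residue_preim _ _ (fun i => i \in image val B)).
congr (_ * _)%N; rewrite big_mkord -sum1_card [RHS]big_mkcond.
by apply: eq_bigr => r _; rewrite mem_image_val; case: (r \in B).
Qed.

(** The [h]-th and [d]-th powers of the cycle generate the same group, so a fixed set is invariant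
    under rotation by [d]. *)
Lemma fix_sigmaX_periodic (n h : nat) (X : {set 'I_(n.*2)}) :
  let d := gcdn n h in (0 < n)%N ->
  reflect ((X \subset cycle_support n) /\ ('P^*)%act X (sigma_cycle n ^+ h)%g = X)
          (X \in [set periodic_set n B | B in [set: {set 'I_d}]]).
Proof.
move=> d n_gt0; have d_gt0 : (0 < d)%N by rewrite gcdn_gt0 n_gt0.
have d_n : (d %| n)%N := dvdn_gcdl n h; have d_h : (d %| h)%N := dvdn_gcdr n h.
apply: (iffP imsetP) => [[B _ ->] | [sXL fixX]].
  split; first by apply/subsetP=> i; rewrite !inE => /andP[].
  apply/setact_permP => i; rewrite !inE val_sigma_cycleX.
  case: ifP => lt_in; last by rewrite lt_in.
  by rewrite ltn_pmod // modn_dvdm // -modnDmr (eqP d_h) addn0.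
have stab_d : (sigma_cycle n ^+ d)%g \in 'C[X | 'P^*]%g.
  have stab_h : (sigma_cycle n ^+ h)%g \in 'C[X | 'P^*]%g by apply/astab1P.
  (* Since [n] divides [d + a * h], the [d]-th power is inverse to a power of the [h]-th one. *)
  have [a _ n_dvd] := Bezoutl h n_gt0; rewrite -/d in n_dvd.
  have: (sigma_cycle n ^+ (d + a * h))%g = 1%g.
    by apply/eqP; rewrite -order_dvdn order_sigma_cycle.
  rewrite expgD mulnC expgM => /eqP.
  by rewrite -eq_invg_mul => /eqP E; rewrite -groupV E groupX.
have le_d2n : (d <= n.*2)%N.
  by rewrite (leq_trans (dvdn_leq n_gt0 d_n)) // -addnn leq_addr.
(* Applying the [d]-th power [i %/ d] times takes [i %% d] to [i]. *)
have modXE (i : 'I_(n.*2)) (lt_id : (i %% d < n.*2)%N) : (i < n)%N ->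
    (Ordinal lt_id \in X) = (i \in X).
  move=> lt_in; have := groupX (i %/ d) stab_d; rewrite -expgM => /astab1P/setact_permP <-.
  congr (_ \in X); apply/val_inj; rewrite /= val_sigma_cycleX /=.
  by rewrite (leq_ltn_trans (leq_mod _ _)) // addnC mulnC -divn_eq modn_small.
exists [set r | widen_ord le_d2n r \in X]; rewrite ?inE //.
apply/setP=> i; rewrite inE; case: ltnP => [lt_in | le_ni] /=; last first.
  by apply: contraTF le_ni => /(subsetP sXL); rewrite inE -ltnNge.
rewrite -[(i %% d)%N]/(val (Ordinal (ltn_pmod i d_gt0))) mem_image_val inE.
rewrite -(modXE i (leq_trans (ltn_pmod i d_gt0) le_d2n) lt_in).
by congr (_ \in X); apply/val_inj.
Qed.

Lemma periodic_set_inj (n d : nat) : (0 < n)%N -> (d %| n)%N ->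
  injective (@periodic_set n d).
Proof.
move=> n_gt0 d_n B1 B2 /setP eqB; apply/setP=> r.
have lt_rn : (r < n)%N := leq_trans (ltn_ord r) (dvdn_leq n_gt0 d_n).
have lt_r2n : (r < n.*2)%N by rewrite -addnn ltn_addr.
by have := eqB (Ordinal lt_r2n); rewrite !inE lt_rn /= modn_small // !mem_image_val.
Qed.

Lemma card_fix_sigmaX (n h k : nat) : let d := gcdn n h in (0 < n)%N ->
  #|'Fix_([set X : {set 'I_(n.*2)} | (X \subset cycle_support n) && (#|X| == k)]
          | 'P^*)[sigma_cycle n ^+ h]%g|
    = if (n %/ d %| k)%N then 'C(d, k * d %/ n) else 0%N.
Proof.
move=> d n_gt0; have d_n : (d %| n)%N := dvdn_gcdl n h.
have d_gt0 : (0 < d)%N by rewrite gcdn_gt0 n_gt0.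
have nd_gt0 : (0 < n %/ d)%N by rewrite divn_gt0 // dvdn_leq.
(* A fixed set consists of [#|B|] residue classes with [n %/ d] points each. *)
transitivity #|[set B : {set 'I_d} | n %/ d * #|B| == k]%N|.
  rewrite -(card_imset _ (periodic_set_inj n_gt0 d_n)); congr #|pred_of_set _|.
  apply/setP=> X; rewrite in_setI inE; apply/andP/imsetP.
    case=> /andP[sXL cardX] /afix1P fixX.
    have /imsetP[B _ defX] := introT (fix_sigmaX_periodic h X n_gt0) (conj sXL fixX).
    by exists B; rewrite // inE -(card_periodic_set _ d_n) -defX.
  case=> B; rewrite inE => cardB defX.
  have /(fix_sigmaX_periodic h X n_gt0)[-> /afix1P->] :
      X \in [set periodic_set n B | B in [set: {set 'I_d}]].
    by rewrite defX imset_f.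
  by rewrite defX card_periodic_set.
case: ifP => [dvd_k | ndvd_k].
  (* Here [k * d %/ n] is [k %/ (n %/ d)], the forced number of classes. *)
  rewrite -[d in RHS]card_ord -card_draws; apply: eq_card => B; rewrite !inE.
  rewrite card_ord -{2}(divnK d_n) divnMr // -(divnK dvd_k) mulnC.
  by rewrite mulnK // eqn_pmul2r.
by apply/eqP; rewrite cards_eq0; apply/eqP/setP=> B; rewrite !inE;
  apply: contraFF ndvd_k => /eqP <-; apply: dvdn_mulr.
Qed.

Lemma card_sigma_orbits_eq (n k : nat) : (0 < n)%N ->
  (#|sigma_orbits n (pred1 k)| * n
    = \sum_(h < n) if n %/ gcdn n h %| k then 'C(gcdn n h, k * gcdn n h %/ n) else 0)%N.
Proof.
move=> n_gt0; set s := sigma_cycle n; have os : #[s]%g = n := order_sigma_cycle n_gt0.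
set S := [set X : {set 'I_(n.*2)} | (X \subset cycle_support n) && (#|X| == k)].
have actsS : [acts <[s]>%g, on S | 'P^*].
  apply/subsetP=> a a_s; rewrite !inE /=; apply/subsetP=> X.
  rewrite !inE card_setact => /andP[sXL ->].
  by rewrite -(cycle_support_act a_s) imsetS.
have /esym := Frobenius_Cauchy actsS; rewrite -orderE os => ->.
(* As the cycle has order [n], exponents [h < n] list its powers without repetition. *)
transitivity (\sum_(a in [set (s ^+ h)%g | h : 'I_n]) #|'Fix_(S | 'P^*)[a]%g|)%N.
  apply: eq_bigl => a; apply/idP/imsetP => [/cyclePmin[h + ->] | [h _ ->]].
    by rewrite -/s os => lt_hn; exists (Ordinal lt_hn).
  exact: mem_cycle.
rewrite big_imset /=; last first.
  move=> i j _ _ /eqP; rewrite eq_expg_mod_order os !modn_small // => /eqP.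
  exact: val_inj.
by apply: eq_bigr => h _; rewrite card_fix_sigmaX.
Qed.

Theorem theorem3p5 (k n : nat) (hk : (1 <= k)%N) (hn : (k.*2 <= n)%N) :
  '[phi_ind n, chi2 n.*2 k] =
  (n%:R)^-1 * ('C(n, k) +
     \sum_(2 <= h < n | (gcdn n h != 1) && (n %/ gcdn n h %| k))
        'C(gcdn n h, k * gcdn n h %/ n))%N%:R.
Proof.
have n_gt1 : (1 < n)%N by apply: leq_trans hn; rewrite -addnn (leq_add hk hk).
have n_gt0 := ltnW n_gt1.
have lt_kn : (k < n)%N by apply: leq_trans hn; rewrite -addnn -addn1 leq_add2l.
have le_n2n : (n <= n.*2)%N by rewrite -addnn leq_addr.
rewrite chi2E ?leq_double ?(ltnW lt_kn) // cfdotBr.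
rewrite !cfdot_Ind1_young ?(leq_trans _ le_n2n) ?(leq_trans (leq_pred k)) ?(ltnW lt_kn) //.
rewrite !card_cent_sigma_orbits ?(leq_trans (leq_pred k)) ?(ltnW lt_kn) //.
(* Orbits on sets of size at most [k - 1] cancel, leaving those of size exactly [k]. *)
rewrite -[in X in X - _](prednK hk) card_sigma_orbits_leq natrD addrAC subrr add0r (prednK hk).
apply: (mulfI (_ : n%:R != 0)); first by rewrite pnatr_eq0 -lt0n.
rewrite mulVKf ?pnatr_eq0 -?lt0n // -natrM mulnC card_sigma_orbits_eq //.
congr (_%:R); rewrite -(big_mkord xpredT (fun h => if n %/ gcdn n h %| k then 'C(gcdn n h, k * gcdn n h %/ n) else 0)%N).
have no_unit : (n %| k)%N = false by rewrite gtnNdvd.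
(* The term [h = 0] has gcd [n] and gives ['C(n, k)]; the term [h = 1] vanishes because
   [0 < k < n]. *)
rewrite big_ltn // big_ltn // gcdn0 divnn n_gt0 dvd1n mulnK //.
rewrite gcdn1 divn1 no_unit add0n -big_mkcond; congr (_ + _)%N.
(* A gcd equal to [1] would require [n %| k], so both filters select the same [h]. *)
apply: eq_bigl => h; case: eqP => //= ->; by rewrite divn1 no_unit.
Qed.
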